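(* Let $0<\alpha<1$ and $\lambda<0$. There is a constant $c_\alpha>0$ (independent of $t$) with the following property. Let $f:\mathbb{R}\to\mathbb{R}$ satisfy the one-sided Lipschitz condition $\langle f(u)-f(v),u-v\rangle\le \lambda\|u-v\|^2$ for all $u,v\in\mathbb{R}$, and let $x,y\in C[0,+\infty)\cap C^1(0,+\infty)$ be two solutions of the scalar equation ${}^{C}_{0}D_t^{\alpha}x(t)=f(x(t))$, $t>0$, with initial values $x(0)=x_0$ and $y(0)=y_0$. Then $$\|x(t)-y(t)\|\le \|x_0-y_0\|\cdot\frac{c_\alpha}{t^{\alpha}}\quad\text{as } t\to+\infty,$$ i.e. the inequality holds for all sufficiently large $t$.
   Context: For $0<\alpha<1$ the Caputo fractional derivative is ${}^{C}_{0}D_t^{\alpha}x(t)=\frac{1}{\Gamma(1-\alpha)}\int_0^t\frac{x'(\tau)}{(t-\tau)^{\alpha}}\,d\tau$ for $t>0$. A solution of the equation is a function for which this derivative is defined for $t>0$ and the equation holds. On $\mathbb{R}$, $\langle u,v\rangle=uv$ and $\|u\|=|u|$. *)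

(* Defs.v *)
From Stdlib Require Import Reals.
From Coquelicot Require Import Coquelicot.

Open Scope R_scope.

Definition Gamma (s : R) : R :=
  RInt_gen (fun u => Rpower u (s - 1) * exp (- u))
    (at_right 0) (Rbar_locally p_infty).

Definition caputo_integrand (alpha : R) (x : R -> R) (t tau : R) : R :=
  Derive x tau / Rpower (t - tau) alpha.

(* The integral over (0, t) is improper at both ends: the kernel is singular
   at [t], and [Derive x] may be unbounded near [0] when [x] is C^1 on the open
   half-line only.  For [x] of class C^1 on (0, +oo), absolute (Lebesgue)
   integrability on (0, t) implies existence of this integral, with the same
   value. *)
Definition ex_caputo (alpha : R) (x : R -> R) (t : R) : Prop :=
  ex_RInt_gen (caputo_integrand alpha x t) (at_right 0) (at_left t).

(* Meaningful under [ex_caputo alpha x t]: [RInt_gen] is a total operator. *)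
Definition caputo (alpha : R) (x : R -> R) (t : R) : R :=
  / Gamma (1 - alpha) *
    RInt_gen (caputo_integrand alpha x t) (at_right 0) (at_left t).

Definition is_caputo_solution (alpha : R) (f x : R -> R) : Prop :=
  forall t, 0 < t -> ex_caputo alpha x t /\ caputo alpha x t = f (x t).

(* [continuous_on] uses the relative topology of the half-line, so only
   right-continuity is required at [0]. *)
Definition C0_closed_C1_open (x : R -> R) : Prop :=
  continuous_on (fun t => 0 <= t) x /\
  (forall t, 0 < t -> ex_derive x t /\ continuous (Derive x) t).

Definition one_sided_Lipschitz (lambda : R) (f : R -> R) : Prop :=
  forall u v : R, (f u - f v) * (u - v) <= lambda * Rabs (u - v) ^ 2.

(* Main.v *)
Require Import Defs.
From Stdlib Require Import Reals Lra.
From Coquelicot Require Import Coquelicot.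
Open Scope R_scope.

(** Put [w = x - y] and [mu = - lambda * Gamma (1 - alpha) > 0].  The one-sided
    Lipschitz condition says that the unnormalised Caputo integral
    [I t = int_0^t w'(s) (t - s)^(-alpha) ds] satisfies
    [I t * w t <= - mu * (w t)^2].  The claim is a maximum principle for this
    inequality, with the explicit barrier [u s = (1 + s / T)^(-alpha)]
    ([decay]), which satisfies [u 0 = 1] and [u t <= T^alpha / t^alpha].

    Let [w / u] reach its maximum over a segment [[0, b]] at [t], with value
    [B], and suppose [B > |w 0|].  Then [t > 0], and [v = w - B u] is nonpositive
    on [[0, t]] with [v t = 0].  The kernel [(t - s)^(-alpha)] increases in [s],
    so [v' (t - s)^(-alpha) >= (v (t - s)^(-alpha))'], and integrating,
    [int v' (t - s)^(-alpha) >= - v 0 * t^(-alpha) > 0].  It remains to bound the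
    contribution of [B u'], and for this
    [P s = (t - s)^(1 - alpha) (T + s)^(-alpha)] is a convenient primitive:
    [- P'] is [(t - s)^(-alpha) (T + s)^(-alpha - 1)] times a convex combination
    of [T + s] and [t - s], which is at least [min (alpha, 1 - alpha) (T + t)],
    while [- u' (t - s)^(-alpha)] is the same product of powers times
    [alpha T^alpha].  When [T^alpha] is a large enough
    multiple of [1 / mu] this gives [I t > - mu * w t]
    ([caputo_integral_at_contact]), contradicting the dissipation inequality at
    [t], where [w t > 0].  So [w <= |w 0| u] ([decay_comparison]); exchanging
    [x] and [y] bounds [|w|], and [c = T^alpha] depends on [alpha] and [lambda]
    only.

    Both steps are carried out at once by comparing the integrand with the
    derivative of a single explicit function on [(0, t)], so the improper
    integral never has to be integrated by parts
    ([primitive_increment_le_RInt_gen]).  The sign of [mu] requires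
    [Gamma (1 - alpha) > 0], which includes the convergence of Euler's integral
    ([Gamma_gt0]). *)

(** * Powers with a real exponent *)

Lemma is_derive_Rpower_l (p x : R) : 0 < x ->
  is_derive (fun z => Rpower z p) x (p * Rpower x (p - 1)).
Proof. intros hx; apply is_derive_Reals, derivable_pt_lim_power; exact hx. Qed.

Lemma continuous_Rpower_l (p x : R) : 0 < x -> continuous (fun z => Rpower z p) x.
Proof.
  intros hx; apply (ex_derive_continuous (fun z => Rpower z p)).
  eexists; apply is_derive_Rpower_l; exact hx.
Qed.

Lemma Rpower_gt0 (x p : R) : 0 < Rpower x p.
Proof. apply exp_pos. Qed.

Lemma Rpower_1_plus (x p : R) : 0 < x -> Rpower x (1 + p) = x * Rpower x p.
Proof. intros hx; rewrite Rpower_plus, Rpower_1 by exact hx; reflexivity. Qed.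

Lemma Rpower_le_1_plus (s u : R) : 0 < s < 1 -> 0 < u -> Rpower u s <= 1 + u.
Proof.
  intros hs hu.
  apply Rle_trans with (Rpower (1 + u) s).
  { apply Rle_Rpower_l; lra. }
  rewrite <- (Rpower_1 (1 + u)) at 2 by lra.
  apply Rle_Rpower; lra.
Qed.

Lemma is_derive_Rpower_minus (p t s : R) : s < t ->
  is_derive (fun z => Rpower (t - z) p) s (- p * Rpower (t - s) (p - 1)).
Proof.
  intros hs; evar_last.
  { apply (is_derive_comp (fun z => Rpower z p) (fun z => t - z)).
    - apply is_derive_Rpower_l; lra.
    - auto_derive; [auto | reflexivity]. }
  unfold scal; simpl; unfold mult; simpl; ring.
Qed.

Lemma is_derive_Rpower_plus (p T s : R) : 0 < T + s ->
  is_derive (fun z => Rpower (T + z) p) s (p * Rpower (T + s) (p - 1)).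
Proof.
  intros hs; evar_last.
  { apply (is_derive_comp (fun z => Rpower z p) (fun z => T + z)).
    - apply is_derive_Rpower_l; lra.
    - auto_derive; [auto | reflexivity]. }
  unfold scal; simpl; unfold mult; simpl; ring.
Qed.

Lemma filterlim_Rpower_0 (p : R) : 0 < p ->
  filterlim (fun z => Rpower z p) (at_right 0) (locally 0).
Proof.
  intros hp; apply filterlim_locally; intros eps.
  exists (mkposreal (Rpower eps (/ p)) (Rpower_gt0 _ _)); intros z hz hz0.
  apply Rabs_def2 in hz; unfold minus, plus, opp in hz; simpl in hz.
  assert (hlt : Rpower z p < Rpower (Rpower eps (/ p)) p) by (apply Rlt_Rpower_l; lra).
  rewrite Rpower_mult, Rinv_l, Rpower_1 in hlt by (destruct eps; simpl; lra).
  assert (h := Rpower_gt0 z p).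
  apply Rabs_def1; unfold minus, plus, opp; simpl; lra.
Qed.

Lemma filterlim_Rpower_minus_0 (p t : R) : 0 < p ->
  filterlim (fun s => Rpower (t - s) p) (at_left t) (locally 0).
Proof.
  intros hp; apply (filterlim_comp _ _ _ (fun s => t - s) (fun z => Rpower z p) _ (at_right 0));
    [| apply filterlim_Rpower_0; exact hp].
  intros P [eps hP]; exists eps; intros s hs hst; apply hP; [| lra].
  apply Rabs_def2 in hs; unfold minus, plus, opp in hs; simpl in hs.
  apply Rabs_def1; unfold minus, plus, opp; simpl; lra.
Qed.

(** * Limits and continuity *)

Lemma filterlim_Rmult {T : Type} (F : (T -> Prop) -> Prop) {FF : Filter F}
    (f g : T -> R) (a b : R) :
  filterlim f F (locally a) -> filterlim g F (locally b) ->
  filterlim (fun s => f s * g s) F (locally (a * b)).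
Proof.
  intros hf hg; exact (filterlim_comp_2 f g Rmult hf hg (filterlim_mult a b)).
Qed.

Lemma filterlim_Rplus {T : Type} (F : (T -> Prop) -> Prop) {FF : Filter F}
    (f g : T -> R) (a b : R) :
  filterlim f F (locally a) -> filterlim g F (locally b) ->
  filterlim (fun s => f s + g s) F (locally (a + b)).
Proof.
  intros hf hg; exact (filterlim_comp_2 f g Rplus hf hg (filterlim_plus a b)).
Qed.

Ltac limit_mult := apply filterlim_Rmult; [typeclasses eauto | |].
Ltac limit_plus := apply filterlim_Rplus; [typeclasses eauto | |].

Lemma continuous_at_right (f : R -> R) (a : R) :
  continuous f a -> filterlim f (at_right a) (locally (f a)).
Proof. intros hf; apply (filterlim_filter_le_1 f (filter_le_within (F := locally a) _) hf). Qed.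

Lemma continuous_at_left (f : R -> R) (a : R) :
  continuous f a -> filterlim f (at_left a) (locally (f a)).
Proof. intros hf; apply (filterlim_filter_le_1 f (filter_le_within (F := locally a) _) hf). Qed.

Lemma continuous_derive (f : R -> R) (s d : R) : is_derive f s d -> continuous f s.
Proof. intros h; apply (ex_derive_continuous f); exists d; exact h. Qed.

(** Continuity at [0] is one-sided, while the extreme value theorem asks for
    two-sided continuity: it is applied to the even extension [w (Rabs s)]. *)
Lemma attains_max_on_segment (w : R -> R) (b : R) :
  0 <= b -> continuous_on (fun s => 0 <= s) w ->
  exists t, 0 <= t <= b /\ forall s, 0 <= s <= b -> w s <= w t.
Proof.
  intros hb hw.
  destruct (continuity_ab_maj (fun s => w (Rabs s)) 0 b hb) as [t [hmax ht]].
  { intros c hc; apply continuity_pt_filterlim.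
    apply (filterlim_comp _ _ _ Rabs w _ (within (fun s => 0 <= s) (locally (Rabs c))));
      [| apply hw, Rabs_pos].
    intros P hP.
    assert (h := continuous_Rabs c _ hP); revert h; unfold filtermap.
    apply filter_imp; intros s h; apply h, Rabs_pos. }
  exists t; split; [exact ht|]; intros s hs.
  specialize (hmax s hs); rewrite !Rabs_pos_eq in hmax by lra; exact hmax.
Qed.

(** * Improper integrals *)

(** The only way in which the Caputo integral is estimated below.  Both its
    ends are improper, so the comparison is made on [[a, b]] inside [(0, t)]
    and passed to the limit; the one-sided limits of [Phi] replace the boundary
    terms. *)
Lemma primitive_increment_le_RInt_gen (t l Phi0 Phit : R) (g Phi dPhi : R -> R) :
  0 < t ->
  is_RInt_gen g (at_right 0) (at_left t) l ->
  (forall s, 0 < s < t -> is_derive Phi s (dPhi s)) ->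
  (forall s, 0 < s < t -> continuous dPhi s) ->
  (forall s, 0 < s < t -> dPhi s <= g s) ->
  filterlim Phi (at_right 0) (locally Phi0) ->
  filterlim Phi (at_left t) (locally Phit) ->
  Phit - Phi0 <= l.
Proof.
  intros ht hg hd hc hle h0 h1.
  apply le_epsilon; intros eps heps.
  assert (e3 : 0 < eps / 3) by lra.
  pose (e := mkposreal _ e3).
  assert (near0 : at_right 0 (fun a => 0 < a < t / 2 /\ ball Phi0 e (Phi a))).
  { apply filter_and.
    - exists (mkposreal (t / 2) (ltac:(lra))); intros a ha ha0.
      apply Rabs_def2 in ha; unfold minus, plus, opp in ha; simpl in ha; lra.
    - apply h0; apply locally_ball. }
  assert (neart : at_left t (fun b => t / 2 < b < t /\ ball Phit e (Phi b))).
  { apply filter_and.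
    - exists (mkposreal (t / 2) (ltac:(lra))); intros b hb hb0.
      apply Rabs_def2 in hb; unfold minus, plus, opp in hb; simpl in hb; lra.
    - apply h1; apply locally_ball. }
  assert (near := hg (ball l e) (locally_ball l e)); unfold filtermapi in near.
  assert (both := Filter_prod (at_right 0) (at_left t)
    (fun ab => (0 < fst ab < t / 2 /\ ball Phi0 e (Phi (fst ab))) /\
               (t / 2 < snd ab < t /\ ball Phit e (Phi (snd ab))))
    _ _ near0 neart (fun a b ha hb => conj ha hb)).
  destruct (filter_ex _ (filter_and _ _ near both))
    as [[a b] [[v [hv hvl]] [[ha hPa] [hb hPb]]]].
  simpl in hv, ha, hPa, hb, hPb.
  assert (hInt : is_RInt dPhi a b (minus (Phi b) (Phi a))).
  { apply (is_RInt_derive Phi dPhi); intros s hs;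
      rewrite Rmin_left, Rmax_right in hs by lra; [apply hd | apply hc]; lra. }
  assert (hcmp : minus (Phi b) (Phi a) <= v).
  { apply (is_RInt_le dPhi g a b); auto; try lra.
    intros s hs; apply hle; lra. }
  apply Rabs_def2 in hvl; apply Rabs_def2 in hPa; apply Rabs_def2 in hPb.
  unfold minus, plus, opp, e in *; simpl in *; lra.
Qed.

(** For a positive integrand the integrals over [[a, b]] grow with the segment,
    so their supremum is the improper integral. *)
Lemma is_RInt_gen_pos_bounded (f : R -> R) (M : R) :
  (forall s, 0 < s -> 0 < f s) ->
  (forall s, 0 < s -> continuous f s) ->
  (forall a b, 0 < a -> a <= b -> RInt f a b <= M) ->
  exists l, 0 < l /\ is_RInt_gen f (at_right 0) (Rbar_locally p_infty) l.
Proof.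
  intros hpos hcont hM.
  assert (hex : forall a b, 0 < a -> a <= b -> ex_RInt f a b).
  { intros a b ha hab; apply (ex_RInt_continuous f).
    intros s hs; rewrite Rmin_left in hs by lra; apply hcont; lra. }
  destruct (completeness (fun z => exists a b, 0 < a /\ a <= b /\ z = RInt f a b))
    as [l [hub hlub]].
  { exists M; intros z (a & b & ha & hab & ->); auto. }
  { exists (RInt f 1 2), 1, 2; repeat split; lra. }
  exists l; split.
  { apply Rlt_le_trans with (RInt f 1 2).
    - apply RInt_gt_0; [lra | |]; intros; [apply hpos | apply hcont]; lra.
    - apply hub; exists 1, 2; repeat split; lra. }
  intros P [eps hP].
  assert (hnear : exists a b, 0 < a /\ a <= b /\ l - eps < RInt f a b).
  { apply Classical_Prop.NNPP; intros hno.
    assert (l <= l - eps); [|destruct eps; simpl in *; lra].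
    apply hlub; intros z (a & b & ha & hab & ->).
    apply Rnot_lt_le; intros hlt; apply hno; exists a, b; auto. }
  destruct hnear as (a0 & b0 & ha0 & hab0 & hl0).
  apply (Filter_prod _ _ _ (fun a => 0 < a < a0) (fun b => b0 < b)).
  { exists (mkposreal a0 ha0); intros a ha hapos.
    apply Rabs_def2 in ha; unfold minus, plus, opp in ha; simpl in ha; lra. }
  { exists b0; auto. }
  intros a b ha hb; simpl.
  exists (RInt f a b); split; [apply (RInt_correct f), hex; lra |].
  apply hP.
  assert (hle : RInt f a b <= l) by (apply hub; exists a, b; repeat split; lra).
  assert (h1 : RInt f a b = RInt f a a0 + (RInt f a0 b0 + RInt f b0 b)).
  { rewrite <- (RInt_Chasles f a a0 b), <- (RInt_Chasles f a0 b0 b);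
      [reflexivity | apply hex; lra ..]. }
  assert (h2 : 0 <= RInt f a a0)
    by (apply RInt_ge_0; [lra | apply hex; lra | intros; apply Rlt_le, hpos; lra]).
  assert (h3 : 0 <= RInt f b0 b)
    by (apply RInt_ge_0; [lra | apply hex; lra | intros; apply Rlt_le, hpos; lra]).
  apply Rabs_def1; unfold minus, plus, opp; simpl; destruct eps; simpl in *; lra.
Qed.

(** * Positivity of the Gamma function *)

(** Convergence follows from the bounded function
    [H u = (u^s - (2 + u)) e^(-u) / s]: since [- (2 + u) e^(-u)] has derivative
    [(1 + u) e^(-u)] and [u^s <= 1 + u], its derivative dominates
    [u^(s - 1) e^(-u)]. *)
Lemma Gamma_gt0 (s : R) : 0 < s < 1 -> 0 < Gamma s.
Proof.
  intros hs.
  set (f := fun u => Rpower u (s - 1) * exp (- u)).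
  assert (hcexp : forall u, continuous (fun u => exp (- u)) u).
  { intros u; apply (ex_derive_continuous (fun u => exp (- u))); auto_derive; auto. }
  assert (hcont : forall u, 0 < u -> continuous f u).
  { intros u hu; apply (continuous_mult (fun u => Rpower u (s - 1)) (fun u => exp (- u)));
      auto using continuous_Rpower_l. }
  destruct (is_RInt_gen_pos_bounded f (3 / s)) as (l & hl & hint); auto.
  { intros u hu; apply Rmult_lt_0_compat; apply exp_pos. }
  { intros a b ha hab.
    pose (H := fun u => (Rpower u s - (2 + u)) * exp (- u) / s).
    pose (dH := fun u => f u + (1 + u - Rpower u s) * exp (- u) / s).
    assert (hH : is_RInt dH a b (minus (H b) (H a))).
    { apply (is_RInt_derive H dH); intros u hu; rewrite Rmin_left in hu by lra.
      - unfold H, dH, f.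
        evar_last.
        { apply (is_derive_ext (fun u => (Rpower u s - (2 + u)) * (exp (- u) / s))).
          { intros z; symmetry; apply Rmult_assoc. }
          apply (is_derive_mult (fun u => Rpower u s - (2 + u)) (fun u => exp (- u) / s)).
          - apply (is_derive_minus (fun u => Rpower u s) (fun u => 2 + u)).
            + apply is_derive_Rpower_l; lra.
            + auto_derive; [auto | reflexivity].
          - auto_derive; [auto | reflexivity].
          - intros; apply Rmult_comm. }
        unfold minus, plus, mult, opp; simpl.
        lazymatch goal with |- @eq _ ?p ?q => change (@eq R p q) end.
        field; lra.
      - apply (continuous_plus f (fun u => (1 + u - Rpower u s) * exp (- u) / s));
          [apply hcont; lra |].
        apply (continuous_mult (fun u => (1 + u - Rpower u s) * exp (- u)) (fun _ => / s));
          [| apply continuous_const].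
        apply (continuous_mult (fun u => 1 + u - Rpower u s) (fun u => exp (- u))); auto.
        apply (continuous_minus (fun u => 1 + u) (fun u => Rpower u s)).
        + apply (ex_derive_continuous (fun u => 1 + u)); auto_derive; auto.
        + apply continuous_Rpower_l; lra. }
    assert (hf : is_RInt f a b (RInt f a b)).
    { apply (RInt_correct f), (ex_RInt_continuous f).
      intros u hu; rewrite Rmin_left in hu by lra; apply hcont; lra. }
    assert (hle : RInt f a b <= minus (H b) (H a)).
    { apply (is_RInt_le f dH a b); auto.
      intros u hu; unfold dH.
      assert (hp := Rpower_le_1_plus s u hs ltac:(lra)).
      assert (0 <= (1 + u - Rpower u s) * exp (- u) / s); [|lra].
      apply Rmult_le_pos; [apply Rmult_le_pos; [lra | apply Rlt_le, exp_pos]|].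
      apply Rlt_le, Rinv_0_lt_compat; lra. }
    apply Rle_trans with (1 := hle).
    unfold H, minus, plus, opp; simpl.
    assert (hpb := Rpower_le_1_plus s b hs ltac:(lra)).
    assert (hpa := Rpower_gt0 a s).
    assert (heb := exp_pos (- b)); assert (hea := exp_pos (- a)).
    assert (hea1 : (1 + a) * exp (- a) <= 1).
    { rewrite exp_Ropp; apply Rmult_le_reg_r with (exp a); [apply exp_pos|].
      field_simplify; [| apply Rgt_not_eq, exp_pos].
      assert (h := exp_ineq1_le a); lra. }
    assert (hB : (Rpower b s - (2 + b)) * exp (- b) <= 0) by nra.
    assert (hA : - ((Rpower a s - (2 + a)) * exp (- a)) <= 3) by nra.
    apply Rle_trans with (((Rpower b s - (2 + b)) * exp (- b)
      + - ((Rpower a s - (2 + a)) * exp (- a))) / s); [right; field; lra|].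
    apply Rmult_le_compat_r; [apply Rlt_le, Rinv_0_lt_compat |]; lra. }
  unfold Gamma; fold f; rewrite (is_RInt_gen_unique f l); auto.
Qed.

(** * The barrier and the singular kernel *)

(** This is [(1 + s / T)^(-alpha)], written so that its derivative and its
    comparison with [T^alpha / s^alpha] need no rescaling. *)
Definition decay (alpha T s : R) : R := Rpower T alpha * Rpower (T + s) (- alpha).

Lemma decay_0 (alpha T : R) : decay alpha T 0 = 1.
Proof.
  unfold decay; rewrite Rplus_0_r, <- Rpower_plus, Rplus_opp_r.
  unfold Rpower; rewrite Rmult_0_l; apply exp_0.
Qed.

Lemma decay_gt0 (alpha T s : R) : 0 < decay alpha T s.
Proof. apply Rmult_lt_0_compat; apply Rpower_gt0. Qed.

Lemma is_derive_decay (alpha T s : R) : 0 < T + s ->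
  is_derive (decay alpha T) s
    (- alpha * Rpower T alpha * Rpower (T + s) (- alpha - 1)).
Proof.
  intros hs; unfold decay; evar_last.
  { apply (is_derive_scal (fun z => Rpower (T + z) (- alpha))).
    apply is_derive_Rpower_plus; exact hs. }
  simpl; ring.
Qed.

Definition kernel_primitive (alpha T t s : R) : R :=
  Rpower (t - s) (1 - alpha) * Rpower (T + s) (- alpha).

Definition kernel_primitive' (alpha T t s : R) : R :=
  - (Rpower (t - s) (- alpha) * Rpower (T + s) (- alpha - 1) *
     ((1 - alpha) * (T + s) + alpha * (t - s))).

Lemma is_derive_kernel_primitive (alpha T t s : R) : 0 < T + s -> s < t ->
  is_derive (kernel_primitive alpha T t) s (kernel_primitive' alpha T t s).
Proof.
  intros hs hst; unfold kernel_primitive, kernel_primitive'; evar_last.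
  { apply (is_derive_mult (fun z => Rpower (t - z) (1 - alpha))
                          (fun z => Rpower (T + z) (- alpha))).
    - apply is_derive_Rpower_minus; exact hst.
    - apply is_derive_Rpower_plus; exact hs.
    - intros; apply Rmult_comm. }
  unfold plus, mult; simpl.
  replace (1 - alpha - 1) with (- alpha) by ring.
  replace (Rpower (t - s) (1 - alpha)) with ((t - s) * Rpower (t - s) (- alpha))
    by (symmetry; apply Rpower_1_plus; lra).
  replace (Rpower (T + s) (- alpha)) with ((T + s) * Rpower (T + s) (- alpha - 1)).
  - ring.
  - rewrite <- Rpower_1_plus by lra; f_equal; ring.
Qed.

(** The last factor of [kernel_primitive'] is at least
    [min (alpha, 1 - alpha)] times [(T + s) + (t - s) = T + t]. *)
Lemma kernel_primitive'_le (alpha T t s : R) : 0 < T + s -> s < t ->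
  kernel_primitive' alpha T t s <=
  - (Rmin alpha (1 - alpha) * (T + t) *
     (Rpower (t - s) (- alpha) * Rpower (T + s) (- alpha - 1))).
Proof.
  intros hs hst; unfold kernel_primitive'; apply Ropp_le_contravar.
  rewrite Rmult_comm; apply Rmult_le_compat_l.
  { apply Rlt_le, Rmult_lt_0_compat; apply Rpower_gt0. }
  assert (h1 := Rmin_l alpha (1 - alpha)); assert (h2 := Rmin_r alpha (1 - alpha)).
  nra.
Qed.

(** A function that is differentiable at its zero [t] is [O(t - s)] there, and
    [(t - s)^(1 - alpha)] tends to [0]. *)
Lemma filterlim_zero_times_kernel (alpha t d : R) (v : R -> R) :
  alpha < 1 -> v t = 0 -> is_derive v t d ->
  filterlim (fun s => v s * Rpower (t - s) (- alpha)) (at_left t) (locally 0).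
Proof.
  intros ha hv hd.
  apply (filterlim_ext_loc (fun s => (v s / (s - t)) * ((-1) * Rpower (t - s) (1 - alpha)))).
  { exists (mkposreal 1 Rlt_0_1); intros s _ hs.
    replace (Rpower (t - s) (1 - alpha)) with ((t - s) * Rpower (t - s) (- alpha))
      by (symmetry; apply Rpower_1_plus; lra).
    field; lra. }
  replace 0 with (d * ((-1) * 0)) by ring.
  limit_mult;
    [| limit_mult;
       [apply filterlim_const | apply filterlim_Rpower_minus_0; lra]].
  apply filterlim_locally; intros eps.
  apply is_derive_Reals in hd.
  destruct (hd eps (cond_pos eps)) as [delta hdelta].
  exists delta; intros s hs hst.
  assert (h := hdelta (s - t) ltac:(lra) hs).
  rewrite hv, Rplus_minus in h.
  rewrite Rminus_0_r in h; exact h.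
Qed.

(** The core estimate, at a point [t] where [w] touches the barrier
    [B * decay] from below: the starting gap [B - w 0] raises the Caputo
    integral by at least [(B - w 0) t^(-alpha)], and the barrier costs at most
    [B * alpha / min (alpha, 1 - alpha) * (T + t)^(-alpha)]. *)
Lemma caputo_integral_at_contact (alpha T B t l : R) (w w' : R -> R) :
  0 < alpha < 1 -> 0 < T -> 0 <= B -> 0 < t ->
  filterlim w (at_right 0) (locally (w 0)) ->
  (forall s, 0 < s -> is_derive w s (w' s)) ->
  (forall s, 0 < s -> continuous w' s) ->
  (forall s, 0 <= s <= t -> w s <= B * decay alpha T s) ->
  w t = B * decay alpha T t ->
  is_RInt_gen (fun s => w' s / Rpower (t - s) alpha) (at_right 0) (at_left t) l ->
  (B - w 0) * Rpower t (- alpha)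
    - B * (alpha / Rmin alpha (1 - alpha) * Rpower (T + t) (- alpha)) <= l.
Proof.
  intros ha hT hB ht hw0 hw hw' hle hcontact hl.
  set (m := Rmin alpha (1 - alpha)).
  assert (hm : 0 < m) by (apply Rmin_pos; lra).
  (* With this factor, [K * kernel_primitive'] is below the barrier's own
     contribution [B * u' s * (t - s)^(-alpha)]. *)
  pose (K := B * (alpha * Rpower T alpha / (m * (T + t)))).
  assert (hK : 0 <= K).
  { apply Rmult_le_pos; [lra | apply Rlt_le, Rdiv_lt_0_compat];
      apply Rmult_lt_0_compat; try lra; apply Rpower_gt0. }
  pose (u' := fun s => - alpha * Rpower T alpha * Rpower (T + s) (- alpha - 1)).
  pose (v := fun s => w s - B * decay alpha T s).
  pose (v' := fun s => w' s - B * u' s).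
  assert (hv : forall s, 0 < s -> is_derive v s (v' s)).
  { intros s hs; apply (is_derive_minus w (fun s => B * decay alpha T s)); [auto|].
    apply is_derive_scal, is_derive_decay; lra. }
  pose (Phi := fun s => v s * Rpower (t - s) (- alpha) + K * kernel_primitive alpha T t s).
  pose (dPhi := fun s =>
    (v' s * Rpower (t - s) (- alpha) + v s * (alpha * Rpower (t - s) (- alpha - 1)))
    + K * kernel_primitive' alpha T t s).
  assert (hfin : 0 - (v 0 * Rpower (t - 0) (- alpha) + K * kernel_primitive alpha T t 0) <= l).
  { apply (primitive_increment_le_RInt_gen t l _ 0 _ Phi dPhi ht hl).
    - intros s hs; apply (is_derive_plus (fun s => v s * Rpower (t - s) (- alpha))
        (fun s => K * kernel_primitive alpha T t s)).
      + evar_last.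
        { apply (is_derive_mult v (fun s => Rpower (t - s) (- alpha)));
            [apply hv; lra | apply is_derive_Rpower_minus; lra | intros; apply Rmult_comm]. }
        unfold plus, mult; simpl; rewrite Ropp_involutive; reflexivity.
      + apply is_derive_scal, is_derive_kernel_primitive; lra.
    - intros s hs.
      assert (hk : forall p, continuous (fun s => Rpower (t - s) p) s)
        by (intros p; eapply continuous_derive, is_derive_Rpower_minus; lra).
      assert (hk2 : forall p, continuous (fun s => Rpower (T + s) p) s)
        by (intros p; eapply continuous_derive, is_derive_Rpower_plus; lra).
      assert (hlin : continuous (fun s => (1 - alpha) * (T + s) + alpha * (t - s)) s)
        by (apply (ex_derive_continuous
              (fun s => (1 - alpha) * (T + s) + alpha * (t - s))); auto_derive; auto).
      assert (hv' : continuous v' s).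
      { apply (continuous_minus w' (fun s => B * u' s)); [apply hw'; lra|].
        unfold u', continuous; limit_mult; [apply filterlim_const|].
        limit_mult; [apply filterlim_const | apply hk2]. }
      assert (hP' : continuous (kernel_primitive' alpha T t) s).
      { apply (continuous_opp (fun s => Rpower (t - s) (- alpha) * Rpower (T + s) (- alpha - 1) *
          ((1 - alpha) * (T + s) + alpha * (t - s)))).
        unfold continuous; limit_mult; [limit_mult; [apply hk | apply hk2] | exact hlin]. }
      unfold dPhi, continuous; limit_plus.
      + limit_plus; [limit_mult; [exact hv' | apply hk] | limit_mult].
        * eapply continuous_derive, hv; lra.
        * limit_mult; [apply filterlim_const | apply hk].
      + limit_mult; [apply filterlim_const | exact hP'].
    - intros s hs; unfold dPhi, v', u', Rdiv; rewrite <- Rpower_Ropp.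
      assert (hv0 : v s <= 0) by (unfold v; specialize (hle s); lra).
      assert (h1 : 0 < alpha * Rpower (t - s) (- alpha - 1))
        by (apply Rmult_lt_0_compat; [lra | apply Rpower_gt0]).
      assert (h2 := kernel_primitive'_le alpha T t s ltac:(lra) ltac:(lra)); fold m in h2.
      apply (Rmult_le_compat_l K) in h2; [| exact hK].
      assert (h3 : K * - (m * (T + t) * (Rpower (t - s) (- alpha) * Rpower (T + s) (- alpha - 1)))
        = - (B * alpha * Rpower T alpha * Rpower (T + s) (- alpha - 1) * Rpower (t - s) (- alpha)))
        by (unfold K; field; lra).
      assert (h4 : v s * (alpha * Rpower (t - s) (- alpha - 1)) <= 0) by nra.
      rewrite h3 in h2; lra.
    - unfold Phi; limit_plus; [limit_mult | limit_mult; [apply filterlim_const |]].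
      + apply (filterlim_comp_2 w (fun s => - (B * decay alpha T s)) Rplus hw0
          (H := locally (- (B * decay alpha T 0)))); [| apply (filterlim_plus (w 0))].
        apply (continuous_at_right (fun s => - (B * decay alpha T s))).
        eapply continuous_derive, (is_derive_opp (fun s => B * decay alpha T s)),
          is_derive_scal, is_derive_decay; lra.
      + eapply (continuous_at_right (fun s => Rpower (t - s) (- alpha))),
          continuous_derive, is_derive_Rpower_minus; lra.
      + eapply continuous_at_right, continuous_derive, is_derive_kernel_primitive; lra.
    - replace 0 with (0 + K * (0 * Rpower (T + t) (- alpha))) by ring.
      unfold Phi; limit_plus; [| limit_mult; [apply filterlim_const | limit_mult]].
      + eapply filterlim_zero_times_kernel; [lra | | apply hv; lra].
        unfold v; rewrite hcontact; ring.
      + apply filterlim_Rpower_minus_0; lra.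
      + eapply (continuous_at_left (fun s => Rpower (T + s) (- alpha))),
          continuous_derive, is_derive_Rpower_plus; lra. }
  apply Rle_trans with (2 := hfin).
  unfold v, K, kernel_primitive; rewrite decay_0, Rminus_0_r, Rplus_0_r.
  assert (hTT : Rpower T alpha * Rpower T (- alpha) = 1)
    by (rewrite <- (decay_0 alpha T); unfold decay; rewrite Rplus_0_r; reflexivity).
  (* It remains to bound [K * kernel_primitive alpha T t 0], which is
     [B * alpha / m * t^(1 - alpha) / (T + t)]. *)
  assert (hmono : Rpower t (1 - alpha) <= (T + t) * Rpower (T + t) (- alpha)).
  { rewrite <- Rpower_1_plus by lra; apply Rle_Rpower_l; lra. }
  assert (h5 : B * (alpha * Rpower T alpha / (m * (T + t))) *
      (Rpower t (1 - alpha) * Rpower T (- alpha))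
    = B * (alpha / m * (Rpower t (1 - alpha) / (T + t)))).
  { transitivity (B * (alpha / m * (Rpower t (1 - alpha) / (T + t)))
      * (Rpower T alpha * Rpower T (- alpha))); [field; lra | rewrite hTT; ring]. }
  assert (h6 : Rpower t (1 - alpha) / (T + t) <= Rpower (T + t) (- alpha)).
  { apply Rmult_le_reg_r with (T + t); [lra|].
    unfold Rdiv; rewrite Rmult_assoc, Rinv_l by lra; lra. }
  assert (h7 : B * (alpha / m * (Rpower t (1 - alpha) / (T + t)))
     <= B * (alpha / m * Rpower (T + t) (- alpha))).
  { apply Rmult_le_compat_l; [lra|]; apply Rmult_le_compat_l; [| exact h6].
    apply Rlt_le, Rdiv_lt_0_compat; lra. }
  rewrite h5; lra.
Qed.

(** Maximum principle: [I t] is the unnormalised Caputo integral of [w], and the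
    condition on [T] makes [decay] decay slowly enough to be a supersolution.
    Maximising the ratio [w / decay], instead of looking for a first crossing
    of a barrier, yields the contact point and also covers [w 0 = 0] without
    approximation. *)
Lemma decay_comparison (alpha T mu : R) (w w' I : R -> R) :
  0 < alpha < 1 -> 0 < T ->
  alpha / Rmin alpha (1 - alpha) <= mu * Rpower T alpha ->
  continuous_on (fun s => 0 <= s) w ->
  (forall s, 0 < s -> is_derive w s (w' s)) ->
  (forall s, 0 < s -> continuous w' s) ->
  (forall t, 0 < t ->
     is_RInt_gen (fun s => w' s / Rpower (t - s) alpha) (at_right 0) (at_left t) (I t)) ->
  (forall t, 0 < t -> I t * w t <= - mu * w t ^ 2) ->
  forall t, 0 <= t -> w t <= Rabs (w 0) * decay alpha T t.
Proof.
  intros ha hT hmu hwc hw hw' hI hdiss b hb.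
  destruct (attains_max_on_segment (fun s => w s / decay alpha T s) b hb) as [t [ht hmax]].
  { intros s hs; unfold Rdiv; limit_mult; [exact (hwc s hs)|].
    apply (filterlim_filter_le_1 (fun z => / decay alpha T z)
      (filter_le_within (F := locally s) (fun z => 0 <= z))).
    apply (continuous_Rinv_comp (decay alpha T)).
    - eapply continuous_derive, is_derive_decay; lra.
    - apply Rgt_not_eq, decay_gt0. }
  set (B := w t / decay alpha T t) in *.
  assert (hle : forall s, 0 <= s <= b -> w s <= B * decay alpha T s).
  { intros s hs; specialize (hmax s hs).
    apply (Rmult_le_compat_r (decay alpha T s)) in hmax; [| apply Rlt_le, decay_gt0].
    unfold Rdiv in hmax; rewrite Rmult_assoc, Rinv_l, Rmult_1_r in hmax
      by apply Rgt_not_eq, decay_gt0; exact hmax. }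
  apply Rle_trans with (1 := hle b ltac:(lra)).
  apply Rmult_le_compat_r; [apply Rlt_le, decay_gt0|].
  apply Rnot_lt_le; intros hlt.
  assert (hw0 := Rle_abs (w 0)); assert (hw0' := Rabs_pos (w 0)).
  assert (hcontact : w t = B * decay alpha T t)
    by (unfold B; field; apply Rgt_not_eq, decay_gt0).
  assert (ht0 : 0 < t).
  { destruct (Rle_lt_or_eq_dec 0 t) as [h | h]; [lra | exact h |].
    rewrite <- h, decay_0 in hcontact; lra. }
  assert (hwt : 0 < w t)
    by (rewrite hcontact; apply Rmult_lt_0_compat; [lra | apply decay_gt0]).
  assert (hlow := caputo_integral_at_contact alpha T B t (I t) w w' ha hT ltac:(lra) ht0).
  specialize (hdiss t ht0).
  assert (hup : I t <= - mu * w t).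
  { apply Rmult_le_reg_r with (w t); [exact hwt|].
    replace (- mu * w t * w t) with (- mu * w t ^ 2) by ring; exact hdiss. }
  assert (hlow' : (B - w 0) * Rpower t (- alpha)
    - B * (alpha / Rmin alpha (1 - alpha) * Rpower (T + t) (- alpha)) <= I t).
  { apply hlow; auto.
    - apply (filterlim_filter_le_1 w (F := within (fun s => 0 <= s) (locally 0)));
        [| apply (hwc 0); lra].
      intros P hP; revert hP; unfold at_right, within; apply filter_imp.
      intros s h hs; apply h; lra.
    - intros s hs; apply hle; lra. }
  assert (hpos : 0 < (B - w 0) * Rpower t (- alpha))
    by (apply Rmult_lt_0_compat; [lra | apply Rpower_gt0]).
  assert (hbal : B * (alpha / Rmin alpha (1 - alpha) * Rpower (T + t) (- alpha)) <= mu * w t).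
  { rewrite hcontact; unfold decay.
    replace (mu * (B * (Rpower T alpha * Rpower (T + t) (- alpha))))
      with (B * (mu * Rpower T alpha * Rpower (T + t) (- alpha))) by ring.
    apply Rmult_le_compat_l; [lra|]; apply Rmult_le_compat_r; [| exact hmu].
    apply Rlt_le, Rpower_gt0. }
  lra.
Qed.

(** The two Caputo integrals are subtracted as convergent integrals, and the
    one-sided Lipschitz condition becomes the dissipation inequality of
    [decay_comparison]; multiplying it by [Gamma (1 - alpha)] keeps its sense. *)
Lemma solution_difference_decay (alpha lambda T : R) (f x y : R -> R) :
  0 < alpha < 1 -> 0 < T ->
  alpha / Rmin alpha (1 - alpha) <= (- lambda * Gamma (1 - alpha)) * Rpower T alpha ->
  one_sided_Lipschitz lambda f ->
  C0_closed_C1_open x -> C0_closed_C1_open y ->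
  is_caputo_solution alpha f x -> is_caputo_solution alpha f y ->
  forall t, 0 <= t -> x t - y t <= Rabs (x 0 - y 0) * decay alpha T t.
Proof.
  intros ha hT hmu hf [hxc hx] [hyc hy] hsx hsy.
  assert (hG : 0 < Gamma (1 - alpha)) by (apply Gamma_gt0; lra).
  assert (hint : forall z, is_caputo_solution alpha f z -> forall t, 0 < t ->
    is_RInt_gen (caputo_integrand alpha z t) (at_right 0) (at_left t)
      (Gamma (1 - alpha) * f (z t))).
  { intros z hz t ht; destruct (hz t ht) as [hex heq].
    rewrite <- heq; unfold caputo.
    rewrite <- Rmult_assoc, Rinv_r, Rmult_1_l by lra.
    exact (RInt_gen_correct _ hex). }
  apply (decay_comparison alpha T (- lambda * Gamma (1 - alpha)) (fun t => x t - y t)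
    (fun t => Derive x t - Derive y t)
    (fun t => Gamma (1 - alpha) * f (x t) - Gamma (1 - alpha) * f (y t))); auto.
  - intros s hs.
    apply (filterlim_comp_2 x (fun z => - y z) Rplus (hxc s hs) (H := locally (- y s)));
      [| apply (filterlim_plus (x s))].
    apply (filterlim_comp _ _ _ y Ropp _ _ _ (hyc s hs)); apply (filterlim_opp (y s)).
  - intros s hs; apply (is_derive_minus x y); apply Derive_correct; [apply hx | apply hy]; auto.
  - intros s hs; apply (continuous_minus (Derive x) (Derive y)); [apply hx | apply hy]; auto.
  - intros t ht.
    assert (h := is_RInt_gen_minus _ _ _ _ (hint x hsx t ht) (hint y hsy t ht)).
    revert h; apply is_RInt_gen_ext, filter_forall; intros ab s _.
    unfold caputo_integrand, minus, plus, opp; simpl; unfold Rdiv; ring.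
  - intros t ht; specialize (hf (x t) (y t)); rewrite pow2_abs in hf.
    apply (Rmult_le_compat_l (Gamma (1 - alpha))) in hf; [lra | lra].
Qed.

Theorem theorem2p3 (alpha lambda : R)
    (alpha_gt0 : 0 < alpha) (alpha_lt1 : alpha < 1) (lambda_lt0 : lambda < 0) :
  exists c : R, 0 < c /\
    forall (f x y : R -> R) (x0 y0 : R),
      one_sided_Lipschitz lambda f ->
      C0_closed_C1_open x -> C0_closed_C1_open y ->
      is_caputo_solution alpha f x -> is_caputo_solution alpha f y ->
      x 0 = x0 -> y 0 = y0 ->
      exists T : R, 0 < T /\
        forall t : R, T < t ->
          Rabs (x t - y t) <= Rabs (x0 - y0) * (c / Rpower t alpha).
Proof.
  set (c := alpha / Rmin alpha (1 - alpha) / (- lambda * Gamma (1 - alpha))).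
  assert (hm : 0 < Rmin alpha (1 - alpha)) by (apply Rmin_pos; lra).
  assert (hG : 0 < Gamma (1 - alpha)) by (apply Gamma_gt0; lra).
  assert (hmu : 0 < - lambda * Gamma (1 - alpha)) by (apply Rmult_lt_0_compat; lra).
  assert (hc : 0 < c) by (repeat apply Rdiv_lt_0_compat; lra).
  exists c; split; [exact hc|].
  intros f x y x0 y0 hf hx hy hsx hsy <- <-.
  (* The bound holds for every positive time, so any threshold will do. *)
  exists 1; split; [lra|]; intros t ht.
  pose (T := Rpower c (/ alpha)).
  assert (hT : 0 < T) by apply Rpower_gt0.
  assert (hTc : Rpower T alpha = c)
    by (unfold T; rewrite Rpower_mult, Rinv_l, Rpower_1; lra).
  assert (hbal : alpha / Rmin alpha (1 - alpha)
      <= (- lambda * Gamma (1 - alpha)) * Rpower T alpha)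
    by (rewrite hTc; unfold c; right; field; lra).
  assert (hdecay : decay alpha T t <= c / Rpower t alpha).
  { unfold decay; rewrite hTc, Rpower_Ropp; apply Rmult_le_compat_l; [lra|].
    apply Rinv_le_contravar; [apply Rpower_gt0 | apply Rle_Rpower_l; lra]. }
  assert (h1 := solution_difference_decay alpha lambda T f x y ltac:(lra) hT hbal
    hf hx hy hsx hsy t ltac:(lra)).
  assert (h2 := solution_difference_decay alpha lambda T f y x ltac:(lra) hT hbal
    hf hy hx hsy hsx t ltac:(lra)).
  rewrite (Rabs_minus_sym (y 0)) in h2.
  apply Rle_trans with (Rabs (x 0 - y 0) * decay alpha T t).
  - apply Rabs_le; lra.
  - apply Rmult_le_compat_l; [apply Rabs_pos | exact hdecay].
Qed.
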